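(* Let $M_n=\sum_{k\ge 0}\binom{n}{2k}C_k$ ($n\in\mathbb{N}$) be the Motzkin numbers, where $C_k=\frac{1}{k+1}\binom{2k}{k}$. Define the sequence $\mathbf{c}=(c_0,c_1,c_2,\ldots)$ by $c_0=1$ and, for $n\ge 0$, $c_{n+1}=c_n+1$ if $(c_n+1)/2$ is not a term of $\mathbf{c}$, and $c_{n+1}=c_n+2$ otherwise (so $\mathbf{c}=(1,3,4,5,7,\ldots)$). Then $M_n$ is even if and only if $n=4c_k-2$ or $n=4c_k-1$ for some $k\in\mathbb{N}$.
   Context: $\mathbb{N}$ denotes the nonnegative integers. Equivalently, $\mathbf{c}$ is the lexicographically least sequence of positive integers such that a positive integer $m$ is a term of $\mathbf{c}$ if and only if $m/2$ is not a term of $\mathbf{c}$. *)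

(* Defs.v *)
From mathcomp Require Import all_boot.

Set Implicit Arguments.
Unset Strict Implicit.
Unset Printing Implicit Defensive.

(* The natural-number quotient is exact, see [dvdn_catalan]. *)
Definition catalan (k : nat) : nat := 'C(2 * k, k) %/ k.+1.

Lemma dvdn_catalan (k : nat) : k.+1 %| 'C(2 * k, k).
Proof.
have cop : coprime k.+1 (2 * k).+1.
  have -> : (2 * k).+1 = k.+1 + k by rewrite addSn mul2n addnn.
  by rewrite /coprime gcdnDl -/(coprime _ _) coprimeSn.
rewrite -(Gauss_dvdr _ cop) mul_bin_diag; exact: dvdn_mulr.
Qed.

(* The terms with k > n are omitted: there 'C(n, 2 * k) = 0. *)
Definition motzkin (n : nat) : nat :=
  \sum_(k < n.+1) 'C(n, 2 * k) * catalan k.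

Definition is_term (c : nat -> nat) (m : nat) : Prop := exists k, c k = m.

(* "x / 2 is a term", with x / 2 an exact rational quotient: for odd x it is
   false. *)
Definition half_is_term (c : nat -> nat) (x : nat) : Prop :=
  exists2 m, 2 * m = x & is_term c m.

(* The recursion refers to the set of all the terms of c, hence a predicate
   on c; [cseq_exists] shows that it is satisfiable. *)
Definition is_cseq (c : nat -> nat) : Prop :=
  c 0 = 1 /\
  forall n,
    (~ half_is_term c (c n + 1) -> c n.+1 = c n + 1) /\
    (half_is_term c (c n + 1) -> c n.+1 = c n + 2).

Lemma cseq_exists : exists c, is_cseq c.
Proof.
pose P m := ~~ odd (logn 2 m).
have P_odd m : odd m -> P m.
  by move=> om; rewrite /P lognE dvdn2 om /= andbF.
have P_dbl m : 0 < m -> P (2 * m) = ~~ P m.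
  by move=> m0; rewrite /P lognM // logn_prime.
pose f m := if P m.+1 then m.+1 else m.+2.
pose c k := iter k f 1.
have cS k : c k.+1 = f (c k) by [].
have cP k : P (c k) && (0 < c k).
  elim: k => [|k _]; first by rewrite andbT; exact: (P_odd 1).
  rewrite cS /f; case: ifPn => [-> //|nP]; apply/andP; split=> //.
  by apply: (P_odd); rewrite oddS; apply: contra nP => o; exact: P_odd.
have cT m : 0 < m -> P m -> is_term c m.
  elim/ltn_ind: m => [] [//|[|m]] IH _ Pm; first by exists 0.
  have [Pm1|nPm1] := boolP (P m.+1).
    by have [k ck] := IH m.+1 (ltnSn _) isT Pm1; exists k.+1; rewrite cS ck /f Pm.
  have om : odd m by apply: contraNT nPm1 => em; apply: (P_odd _).
  have m0 : 0 < m by case: m om {IH Pm nPm1}.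
  have [k ck] := IH m (leqW (ltnSn _)) m0 (P_odd _ om).
  by exists k.+1; rewrite cS ck /f (negPf nPm1).
exists c; split=> // n; rewrite cS /f addn1 addn2; split.
  case: ifPn => // nP [].
  have e : ~~ odd (c n).+1 by apply: contra nP => o; exact: P_odd.
  have Eh : 2 * (c n).+1./2 = (c n).+1 by rewrite mul2n even_halfK.
  have h0 : 0 < (c n).+1./2 by case: _./2 Eh.
  exists (c n).+1./2 => //; apply: cT => //.
  by have := P_dbl _ h0; rewrite Eh (negPf nP) => /esym/negbFE.
case=> m Em [k ck]; move: (cP k); rewrite ck => /andP[Pm m0].
by rewrite -Em P_dbl // Pm.
Qed.

(* Main.v *)
Require Import Defs.
From mathcomp Require Import all_boot.
From mathcomp Require Import zify.

(** By Lucas' theorem modulo 2, M_n has the parity of the sum of C(h, k) C_k over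
    k, where h = n/2 (rounded down).  Now C_0 is odd, C_(2m) is even for m > 0,
    and C_(2m+1) has the parity of C_m; applying Lucas once more, the parity
    g(h) of that sum satisfies g(h) = 1 + [h odd] g(h/2).  Hence M_n is even iff
    the 2-adic valuation of h + 1 is odd, i.e. iff h + 1 = 2m with m of even
    valuation, and these m are exactly the terms of c. *)

(** Pascal's rule applied twice: the middle binomial occurs twice and cancels modulo 2. *)
Lemma odd_bin_double (n k : nat) :
  odd 'C(n.*2, k.*2) = odd 'C(n, k) /\ odd 'C(n.*2, k.*2.+1) = false.
Proof.
elim: n k => [|n IH] k; first by case: k.
case: k => [|k].
  by rewrite double0 !bin0 bin1 odd_double.
have [Ek Ok] := IH k; have [ESk OSk] := IH k.+1.
rewrite !doubleS in ESk OSk *; rewrite !binS !oddD Ok Ek ESk OSk.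
by split; do 2?case: (odd _).
Qed.

Lemma odd_bin_half (n k : nat) : odd 'C(n, k.*2) = odd 'C(n./2, k).
Proof.
have [E1 O1] := odd_bin_double n./2 k.
rewrite -{1}(odd_double_half n); case: (odd n); rewrite ?add0n ?add1n //.
case: k E1 O1 => [|k] E1 O1; first by rewrite !bin0.
rewrite doubleS binS oddD -doubleS E1.
by have [_ ->] := odd_bin_double n./2 k; rewrite addbF.
Qed.

Lemma odd_bin_half_odd (n k : nat) :
  odd 'C(n, k.*2.+1) = odd n && odd 'C(n./2, k).
Proof.
have [E1 O1] := odd_bin_double n./2 k.
rewrite -{1}(odd_double_half n); case: (odd n); rewrite ?add0n ?add1n //.
by rewrite binS oddD E1 O1.
Qed.

Lemma mulSn_catalan (k : nat) : k.+1 * catalan k = 'C(k.*2, k).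
Proof. by rewrite mulnC /catalan mul2n divnK // -mul2n dvdn_catalan. Qed.

(** A division-free form of the Catalan numbers, so that parities can be read off; after
    multiplication by [k.+1] it is absorption. *)
Lemma catalan_bin (k : nat) : catalan k + 'C(k.*2, k.+1) = 'C(k.*2, k).
Proof.
apply/eqP; rewrite -(eqn_pmul2l (ltn0Sn k)) mulnDr mulSn_catalan.
rewrite mul_bin_left -addnn addnK; apply/eqP; lia.
Qed.

Lemma bin_odd_catalan (m : nat) : 'C(m.*2.+1, m.+1) = m.*2.+1 * catalan m.
Proof.
apply/eqP; rewrite -(eqn_pmul2l (ltn0Sn m)) -mul_bin_diag -mulSn_catalan.
by apply/eqP; rewrite mulnCA.
Qed.

(** For positive [k], Pascal's rule splits the central binomial into two summands that are equal by
    symmetry. *)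
Lemma odd_bin_central (k : nat) : odd 'C(k.*2, k) = (k == 0).
Proof.
case: k => // k; rewrite -addnn addSn binS -bin_sub; last by lia.
have -> : k + k.+1 - k.+1 = k by lia.
by rewrite addnn odd_double.
Qed.

Lemma odd_catalan_double (m : nat) : odd (catalan m.*2) = (m == 0).
Proof.
have /(congr1 odd) := catalan_bin m.*2; rewrite oddD odd_bin_central.
by have [_ ->] := odd_bin_double m.*2 m; rewrite addbF double_eq0.
Qed.

(** The central binomial in [catalan_bin] is even, and Lucas reduces the other one to
    ['C(m.*2.+1, m.+1)], an odd multiple of [catalan m]. *)
Lemma odd_catalan_doubleS (m : nat) : odd (catalan m.*2.+1) = odd (catalan m).
Proof.
have /(congr1 odd) := catalan_bin m.*2.+1; rewrite oddD odd_bin_central.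
have [+ _] := odd_bin_double m.*2.+1 m.+1; rewrite doubleS => ->.
by rewrite bin_odd_catalan oddM /= odd_double; do 2!case: (odd _).
Qed.

Lemma big_addb_double (F : nat -> bool) (N : nat) :
  \big[addb/false]_(k < N.*2) F k =
  \big[addb/false]_(k < N) (F k.*2 (+) F k.*2.+1).
Proof.
by elim: N => [|N IH]; rewrite ?big_ord0 // doubleS !big_ord_recr /= IH addbA.
Qed.

Lemma logn2_double (m : nat) : 0 < m -> logn 2 (2 * m) = (logn 2 m).+1.
Proof. by move=> m0; rewrite lognM // logn_prime. Qed.

Lemma logn2_odd (m : nat) : odd m -> logn 2 m = 0.
Proof. by move=> om; rewrite lognE dvdn2 om andbF. Qed.

(** The bound [N] is free so that the induction hypothesis applies to [h./2] over the same range. *)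
Lemma odd_sum_bin_catalan (N h : nat) : h < N ->
  \big[addb/false]_(k < N) (odd 'C(h, k) && odd (catalan k)) =
  ~~ odd (logn 2 h.+1).
Proof.
elim/ltn_ind: h N => h IH N hN.
(* Doubling the range adds only vanishing binomials, and lets the indices be paired as even and
   odd. *)
have -> : \big[addb/false]_(k < N) (odd 'C(h, k) && odd (catalan k)) =
          \big[addb/false]_(k < N.*2) (odd 'C(h, k) && odd (catalan k)).
  rewrite -addnn big_split_ord /= [X in _ (+) X]big1 ?addbF // => i _.
  by rewrite bin_small // (leq_trans hN) // leq_addr.
rewrite (big_addb_double (fun k => odd 'C(h, k) && odd (catalan k))) big_split /=.
have -> : \big[addb/false]_(k < N) (odd 'C(h, k.*2) && odd (catalan k.*2)) = true.
  case: N hN => // N _; rewrite big_ord_recl /= big1 => [|i _].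
    by rewrite bin0 (odd_catalan_double 0).
  by rewrite odd_catalan_double andbC.
have -> : \big[addb/false]_(k < N) (odd 'C(h, k.*2.+1) && odd (catalan k.*2.+1))
    = odd h && \big[addb/false]_(k < N) (odd 'C(h./2, k) && odd (catalan k)).
  case oh: (odd h); last by rewrite big1 // => i _; rewrite odd_bin_half_odd oh.
  by apply: eq_bigr => i _; rewrite odd_bin_half_odd oh odd_catalan_doubleS.
have [oh|eh] := boolP (odd h); last first.
  by rewrite logn2_odd.
rewrite IH; [|lia|lia].
have -> : h.+1 = 2 * h./2.+1 by lia.
by rewrite logn2_double //= negbK.
Qed.

Lemma odd_motzkin (n : nat) : odd (motzkin n) = ~~ odd (logn 2 n./2.+1).
Proof.
rewrite -(@odd_sum_bin_catalan n.+1); last by lia.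
rewrite /motzkin (big_morph odd oddD (erefl : odd 0 = false)).
by apply: eq_bigr => k _; rewrite oddM mul2n odd_bin_half.
Qed.

Section Terms.

Variable c : nat -> nat.
Hypothesis Hc : is_cseq c.

(** Only terms below [x] matter, since [x./2 < x]; this is what the induction on the terms can
    supply. *)
Lemma half_is_term_logn (x : nat) : 0 < x ->
    (forall m, 0 < m < x -> is_term c m <-> ~~ odd (logn 2 m)) ->
  half_is_term c x <-> odd (logn 2 x).
Proof.
move=> x0 IH; split=> [[m Em cm]|ox].
  have m0 : 0 < m by lia.
  by rewrite -Em logn2_double //=; apply/IH => //; lia.
have ex : ~~ odd x by apply: contraL ox => /logn2_odd ->.
have Ex : x = 2 * x./2 by lia.
have h0 : 0 < x./2 by lia.
exists x./2; first by rewrite -Ex.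
by apply/IH; [lia | move: ox; rewrite {1}Ex logn2_double].
Qed.

Lemma cseq_lt (k : nat) : c k < c k.+1.
Proof.
case: Hc => _ /(_ k) [Hn Hy]; rewrite ltnNge; apply/negP => le.
(* No case split on [half_is_term] is available constructively; a failure of growth refutes it, and
   then the other clause forces growth. *)
have nh : ~ half_is_term c (c k + 1) by move/Hy; lia.
by move: (Hn nh); lia.
Qed.

Lemma cseq_homo : {mono c : i j / i <= j}.
Proof. by apply: leq_mono; apply: homo_ltn ltn_trans cseq_lt. Qed.

Lemma cseq_gt (k : nat) : k < c k.
Proof.
elim: k => [|k IH]; first by case: Hc => ->.
exact: leq_ltn_trans IH (cseq_lt k).
Qed.

Lemma is_term_cseq (m : nat) : 0 < m -> is_term c m <-> ~~ odd (logn 2 m).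
Proof.
move=> m0; have: 0 < m <= c m by rewrite m0 ltnW // cseq_gt.
(* The induction is on [n], for all positive [m] up to [c n]; starting from [n = m] suffices because
   [m < c m]. *)
move: {3}m => n; elim: n m {m0} => [|n IH] m.
  have [c0 _] := Hc; rewrite c0 -eqn_leq => /eqP <-.
  by split=> // _; exists 0.
have [_ /(_ n) [Hn Hy]] := Hc; rewrite addn1 addn2 in Hn Hy.
have IHc k : 0 < k < (c n).+1 -> is_term c k <-> ~~ odd (logn 2 k).
  by rewrite ltnS; apply: IH.
have H := half_is_term_logn _ (ltn0Sn (c n)) IHc.
case/andP=> m0 le_m; have [ge_m|gt_m] := leqP m (c n).
  by apply: IH; rewrite m0.
have [oc|ec] := boolP (odd (logn 2 (c n).+1)); last first.
  have cS : c n.+1 = (c n).+1 by apply: Hn => /H; apply/negP.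
  have -> : m = (c n).+1 by lia.
  by split=> // _; exists n.+1.
have cS : c n.+1 = (c n).+2 by apply/Hy/H.
have [->|->] : m = (c n).+1 \/ m = (c n).+2 by lia.
  (* The skipped value lies strictly between consecutive terms, so monotonicity excludes it. *)
  rewrite oc; split=> // -[k ck].
  by have [] := leqP k n; rewrite -cseq_homo; lia.
split=> _; last by exists n.+1.
(* Odd valuation makes [(c n).+1] even, so [(c n).+2] is odd and has valuation 0. *)
rewrite logn2_odd //=; rewrite negbK.
by apply: contraLR oc => /= ec; rewrite logn2_odd.
Qed.

End Terms.

Theorem theorem3p1 (c : nat -> nat) (Hc : is_cseq c) (n : nat) :
  ~~ odd (motzkin n) <-> exists k : nat, n = 4 * c k - 2 \/ n = 4 * c k - 1.
Proof.
rewrite odd_motzkin negbK; split=> [oh|[k Ek]].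
  have eh : ~~ odd n./2.+1 by apply: contraL oh => /logn2_odd ->.
  have Eh : n./2.+1 = 2 * n./2.+1./2 by lia.
  have h0 : 0 < n./2.+1./2 by lia.
  move: oh; rewrite Eh logn2_double //= => /(is_term_cseq _ Hc _ h0)[k ck].
  by exists k; rewrite ck; lia.
(* Positivity makes the truncated subtractions exact, so both forms of [n] give
   [n./2 = 2 * c k - 1]. *)
have ck0 : 0 < c k by apply: leq_ltn_trans (cseq_gt _ Hc k).
have -> : n./2.+1 = 2 * c k by lia.
by rewrite logn2_double //=; apply/(is_term_cseq _ Hc _ ck0); exists k.
Qed.
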